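(* For every positive integer $k$ there is a deterministic algorithm in the ordinal query model that, on every finite metric space $(X,d)$ and every consistent profile, makes at most $2k$ distance queries and outputs a set $C\subseteq X$ with $|C|\le k$ such that $\max_{x\in X}d(x,C)\le 4\cdot\mathrm{OPT}^{\mathrm{center}}_k(X,d)$.
   Context: Ordinal query model: $(X,d)$ is a finite metric space with $|X|=n$. Every point $x\in X$ reports a ranking $\pi_x$ of all points of $X$ such that $y$ is ranked above $y'$ only if $d(x,y)\le d(x,y')$ (ties broken arbitrarily); the collection $P=\{\pi_x\}_{x\in X}$ is a profile consistent with $d$. An algorithm receives $X$, $k$ and $P$ for free. Its only other access to $d$ is by querying the exact value $d(x,y)$ for pairs of its choice; each such value costs one query. For $C\subseteq X$ write $d(x,C)=\min_{c\in C}d(x,c)$. The $k$-center cost of $C$ is $\max_{x\in X}d(x,C)$, and $\mathrm{OPT}^{\mathrm{center}}_k(X,d)=\min_{C\subseteq X,|C|=k}\max_{x\in X}d(x,C)$. *)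

(* Defs.v *)
From mathcomp Require Import all_boot all_order all_algebra.
From mathcomp Require Import reals.
Set Implicit Arguments. Unset Strict Implicit. Unset Printing Implicit Defensive.
Import Order.TTheory GRing.Theory Num.Theory.
Local Open Scope ring_scope.

Definition is_metric (R : realType) (T : finType) (d : T -> T -> R) : Prop :=
  [/\ forall x y, 0 <= d x y,
      forall x y, d x y = 0 <-> x = y,
      forall x y, d x y = d y x
    & forall x y z, d x z <= d x y + d y z].

Definition consistent_profile (R : realType) (T : finType) (d : T -> T -> R)
    (pi : T -> seq T) : Prop :=
  forall x, perm_eq (pi x) (enum T) /\
            pairwise (fun y y' => d x y <= d x y') (pi x).

(* Deterministic adaptive query algorithms as decision trees: either output a
   set of centers, or query d(x,y) and continue depending on the answer. *)
Inductive qtree (T : finType) (R : Type) : Type :=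
| QOut of {set T}
| QAsk of T & T & (R -> qtree T R).

Fixpoint run (T : finType) (R : Type) (d : T -> T -> R) (t : qtree T R)
  : {set T} * nat :=
  match t with
  | QOut C => (C, 0%N)
  | QAsk x y f => let r := run d (f (d x y)) in (r.1, r.2.+1)
  end.

(* The k-center cost of C is at most r: every point is within r of some
   center in C (i.e. max_x d(x,C) <= r, with d(x,set0) = +oo). *)
Definition center_cost_le (R : realType) (T : finType) (d : T -> T -> R)
    (C : {set T}) (r : R) : Prop :=
  forall x, exists2 c, c \in C & d x c <= r.

(* Main.v *)
Require Import Defs.
From mathcomp Require Import all_boot all_order all_algebra.
From mathcomp Require Import reals constructive_ereal.
From mathcomp Require Import zify lra.
Set Implicit Arguments. Unset Strict Implicit. Unset Printing Implicit Defensive.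
Import Order.TTheory GRing.Theory Num.Theory.
Local Open Scope ring_scope.

(** Farthest-point traversal, run lazily for [2k] queries so as to collect
    [2k+1] candidate centers.  Candidates [s] carry an upper bound [u(s)] on
    the radius of their cluster.  Each query takes the candidate [b] with the
    largest bound and asks for [v = d(b, y)], where [y] is the point of the
    cluster of [b] that [b] ranks last.  Then [y] becomes a candidate with
    birth value [v], the bounds of [b] and [y] become [v], and [y] captures the
    points that prefer it to their owner and that lie in its ball of radius
    [v]; the ranking of [y] reveals this ball, since [d(y, b) = v].  Hence
    [d(s, t) >= min (birth s) (birth t)] for any two candidates.

    Let [w] be the [(k+1)]-st largest birth value and output the candidates
    born above [w].  By pigeonhole [w <= 2 OPT].  While some bound exceeds [w],
    the queried [b] is an output candidate, and an answer [<= w] retires [b];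
    so there are at most as many answers [<= w] as output candidates, that is
    at most [k].  As [k+1] of the births are [<= w], all bounds must at some
    moment have been [<= w]: then every point is within [w] of a candidate,
    which is itself within [w] of an output candidate. *)

(** * Rankings and the traversal as a decision tree *)

Lemma consistent_rank (R : realType) (T : finType) (d : T -> T -> R)
    (pi : T -> seq T) (x y z : T) :
  consistent_profile d pi -> (index y (pi x) <= index z (pi x))%N ->
  d x y <= d x z.
Proof.
move=> /(_ x)[pe pw]; rewrite leq_eqVlt => /orP[/eqP e|lt].
  have yin : y \in pi x by rewrite (perm_mem pe) mem_enum.
  have zin : z \in pi x by rewrite (perm_mem pe) mem_enum.
  by rewrite -(nth_index x yin) e nth_index.
have zin : z \in pi x by rewrite (perm_mem pe) mem_enum.
have yin : y \in pi x by rewrite (perm_mem pe) mem_enum.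
move/(pairwiseP x): pw => /(_ (index y (pi x)) (index z (pi x))).
by rewrite !inE !index_mem !nth_index //; apply.
Qed.

(* [nq] queries have been made and the candidates have indices [0 .. nq]; the
   first one is born at [+oo].  Candidates are indexed because a point may
   occur twice among them (one copy then has birth value [0]). *)
Record state (R : realType) (T : finType) := State {
  nq : nat;
  ctr : nat -> T;
  birth : nat -> \bar R;
  rad : nat -> \bar R;
  own : T -> nat }.

Definition start (R : realType) (T : finType) (x0 : T) : state R T :=
  State 0 (fun=> x0) (fun=> +oo%E) (fun=> +oo%E) (fun=> 0%N).

Definition widest (R : realType) (T : finType) (st : state R T) :
    'I_(nq st).+1 :=
  [arg max_(i > ord0) rad st i]%O.

(* The default [ctr st b] is reached when [b] has lost its whole cluster. *)
Definition farthest (R : realType) (T : finType) (pi : T -> seq T)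
    (st : state R T) : T :=
  let b := widest st in
  last (ctr st b) [seq z <- pi (ctr st b) | own st z == b].

Definition steals (R : realType) (T : finType) (pi : T -> seq T)
    (st : state R T) (z : T) : bool :=
  let y := farthest pi st in
  (index z (pi y) <= index (ctr st (widest st)) (pi y))%N &&
  (index y (pi z) <= index (ctr st (own st z)) (pi z))%N.

Definition step (R : realType) (T : finType) (pi : T -> seq T)
    (st : state R T) (v : R) : state R T :=
  let n := (nq st).+1 in
  State n
    (fun i => if i == n then farthest pi st else ctr st i)
    (fun i => if i == n then v%:E else birth st i)
    (fun i => if (i == n) || (i == widest st) then v%:E else rad st i)
    (fun z => if steals pi st z then n else own st z).

(** The count includes [i] itself, and a tie straddling rank [k] is dropped whole, so fewer than [k]
    indices may survive. *)
Definition output (R : realType) (T : finType) (k : nat) (st : state R T) :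
    {set T} :=
  [set ctr st (val i) | i : 'I_(nq st).+1 &
    (#|[set j : 'I_(nq st).+1 | (birth st i <= birth st j)%E]| <= k)%N].

Fixpoint explore (R : realType) (T : finType) (k : nat) (pi : T -> seq T)
    (m : nat) (st : state R T) : qtree T R :=
  if m is m'.+1 then
    QAsk (ctr st (widest st)) (farthest pi st)
      (fun v => explore k pi m' (step pi st v))
  else QOut R (output k st).

Definition dstep (R : realType) (T : finType) (d : T -> T -> R)
    (pi : T -> seq T) (st : state R T) : state R T :=
  step pi st (d (ctr st (widest st)) (farthest pi st)).

Lemma run_explore (R : realType) (T : finType) (d : T -> T -> R)
    (k : nat) (pi : T -> seq T) (m : nat) (st : state R T) :
  run d (explore k pi m st) = (output k (iter m (dstep d pi) st), m).
Proof. by elim: m st => [|m IH] st //=; rewrite IH -iterSr. Qed.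

Lemma nq_iter (R : realType) (T : finType) (d : T -> T -> R)
    (pi : T -> seq T) (m : nat) (st : state R T) :
  nq (iter m (dstep d pi) st) = (m + nq st)%N.
Proof. by elim: m => //= m ->. Qed.

(** * Separation of candidates and bounds on cluster radii *)

Record separated (R : realType) (T : finType) (d : T -> T -> R)
    (st : state R T) : Prop := Separated {
  own_le : forall z, (own st z <= nq st)%N;
  own_rad : forall z, ((d z (ctr st (own st z)))%:E <= rad st (own st z))%E;
  own_near : forall z i, (i <= nq st)%N ->
    (birth st i <= (d z (ctr st i))%:E)%E \/
    d z (ctr st (own st z)) <= d z (ctr st i);
  ctr_sep : forall i j, (i < j <= nq st)%N ->
    (birth st i <= (d (ctr st i) (ctr st j))%:E)%E \/
    (birth st j <= (d (ctr st i) (ctr st j))%:E)%E;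
  rad_ge0 : forall i, (0 <= rad st i)%E;
  rad_birth : forall i, (rad st i <= birth st i)%E }.

Lemma widest_max (R : realType) (T : finType) (st : state R T) (i : nat) :
  (i <= nq st)%N -> (rad st i <= rad st (widest st))%E.
Proof.
move=> le_i; rewrite /widest; case: Order.TotalTheory.arg_maxP => //= b _ max_b.
have lt_i : (i < (nq st).+1)%N by [].
exact: (max_b (Ordinal lt_i)).
Qed.

(** Filtering keeps the order of the ranking, so the last entry is farthest; [z] witnesses a
    nonempty cluster, which excludes the default. *)
Lemma farthest_max (R : realType) (T : finType) (d : T -> T -> R)
    (pi : T -> seq T) (st : state R T) (z : T) :
  consistent_profile d pi -> own st z = widest st ->
  own st (farthest pi st) = widest st /\
  d (ctr st (widest st)) z <= d (ctr st (widest st)) (farthest pi st).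
Proof.
move=> cp oz; rewrite /farthest /=; set b := widest st; set x := ctr st b.
have [pe pw] := cp x.
set l := [seq _ <- _ | _].
have zl : z \in l by rewrite mem_filter oz eqxx (perm_mem pe) mem_enum.
have pwl : pairwise (fun y y' => d x y <= d x y') l by exact: pairwise_filter.
have : {subset l <= [pred t | own st t == b]}.
  by move=> t; rewrite mem_filter => /andP[].
case/lastP: l zl pwl => // l t; rewrite last_rcons mem_rcons inE pairwise_rcons.
move=> zl /andP[/allP al _] sub; split.
  by apply/eqP/(sub t); rewrite mem_rcons mem_head.
by case/orP: zl => [/eqP -> //|/al].
Qed.

Lemma farthest_own (R : realType) (T : finType) (pi : T -> seq T)
    (st : state R T) :
  own st (farthest pi st) = widest st \/
  farthest pi st = ctr st (widest st).
Proof.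
rewrite /farthest /=; set l := [seq _ <- _ | _].
have : {subset l <= [pred t | own st t == widest st]}.
  by move=> t; rewrite mem_filter => /andP[].
case/lastP: l => [|l t] sub; [by right | left; rewrite last_rcons].
by apply/eqP/(sub t); rewrite mem_rcons mem_head.
Qed.

(** Ensures that an answer never raises the bound of the queried candidate, which keeps bounds below
    births. *)
Lemma farthest_rad (R : realType) (T : finType) (d : T -> T -> R)
    (pi : T -> seq T) (st : state R T) :
  is_metric d -> separated d st ->
  ((d (ctr st (widest st)) (farthest pi st))%:E <= rad st (widest st))%E.
Proof.
move=> [_ d0 dC _] sep; case: (farthest_own pi st) => [oy|->].
  by rewrite dC -{1}oy; have := own_rad sep (farthest pi st); rewrite oy.
by rewrite (d0 _ _).2 //; apply: (rad_ge0 sep).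
Qed.

Lemma separated_start (R : realType) (T : finType) (d : T -> T -> R) (x0 : T) :
  separated d (start R x0).
Proof.
split=> //=; try by move=> *; rewrite ?leey.
- by move=> z i _; right.
- by move=> i [|j]; rewrite ?ltn0 ?andbF.
Qed.

Lemma separated_step (R : realType) (T : finType) (d : T -> T -> R)
    (pi : T -> seq T) (st : state R T) :
  is_metric d -> consistent_profile d pi -> separated d st ->
  separated d (dstep d pi st).
Proof.
move=> dm cp sep; have [dge0 d0 dC _] := dm.
have le_v := farthest_rad pi dm sep.
case: (sep) => ole orad onear csep r0 rb.
have neqn i : (i <= nq st)%N -> (i == (nq st).+1) = false by lia.
have ble : (widest st <= nq st)%N by rewrite -ltnS.
have stolen z : steals pi st z ->
    d z (farthest pi st) <= d (ctr st (widest st)) (farthest pi st) /\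
    d z (farthest pi st) <= d z (ctr st (own st z)).
  case/andP=> h1 h2; split; last exact: (consistent_rank cp h2).
  by rewrite dC [X in _ <= X]dC; exact: (consistent_rank cp h1).
split=> /=.
- by move=> z; case: ifP => // _; apply: leqW.
- move=> z; case: (boolP (steals pi st z)) => [/stolen[h _]|_].
    by rewrite !eqxx /= lee_fin.
  rewrite neqn //=; case: ifP => [/eqP oz|_ //].
  by rewrite lee_fin dC oz; case: (farthest_max cp oz).
- move=> z i; rewrite leq_eqVlt ltnS => /orP[/eqP ->|le_i].
    rewrite !eqxx; case st_z: (steals pi st z); first by right; rewrite eqxx.
    rewrite neqn //; move/negbT: st_z; rewrite negb_and -!ltnNge.
    (* Failing the first rank test puts [z] outside the new ball; failing the second makes its owner
       at least as near. *)
    case/orP=> /ltnW /(consistent_rank cp) h; [left | right=> //].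
    by rewrite lee_fin dC [X in _ <= X]dC.
  rewrite (neqn i) //; case: (onear z i le_i) => h; [by left|right].
  case: (boolP (steals pi st z)) => [/stolen[_ h']|_].
    by rewrite eqxx (le_trans h').
  by rewrite neqn.
- move=> i j /andP[lt_ij]; rewrite leq_eqVlt ltnS => /orP[/eqP ej|le_j].
    subst j; rewrite eqxx neqn //.
    (* The new center was owned by [widest], at distance its own birth value, so [own_near] applied
       to it yields separation. In the default case that value is [0]. *)
    case: (farthest_own pi st) => [oy|ey]; last first.
      by right; rewrite lee_fin ey (d0 _ _).2.
    case: (onear (farthest pi st) i) => // h; [left|right].
      by rewrite dC.
    by rewrite lee_fin (dC _ (farthest _ _)) [X in _ <= X]dC -oy.
  have le_i : (i <= nq st)%N by lia.
  by rewrite !neqn //; apply: csep; rewrite lt_ij.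
- by move=> i; case: ifP => // _; rewrite lee_fin.
- move=> i; case: ifP => //= [/orP[-> //|/eqP ->]|/negbT]; last first.
    by rewrite negb_or => /andP[/negbTE ->].
  by rewrite neqn //; apply: le_trans (rb _).
Qed.

(** * Charging small answers to retired candidates *)

Definition covered (R : realType) (T : finType) (d : T -> T -> R) (w : R)
    (st : state R T) : Prop :=
  forall z, exists i, [/\ (i <= nq st)%N, (w%:E < birth st i)%E
    & d z (ctr st i) <= 2 * w].

(* Each candidate born at most [w] is charged to the parent it retired. *)
Definition charged (R : realType) (T : finType) (d : T -> T -> R) (w : R)
    (st : state R T) : Prop :=
  (forall i, (i <= nq st)%N -> (birth st i <= w%:E)%E ->
     exists j, [/\ (j <= nq st)%N, (w%:E < birth st j)%E
       & d (ctr st i) (ctr st j) <= w]) /\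
  (\sum_(i < (nq st).+1) (birth st i <= w%:E)%E <=
   \sum_(i < (nq st).+1) ((w%:E < birth st i) && (rad st i <= w%:E))%E)%N.

(** Kept for arbitrary [w], since the threshold is known only after the last query. *)
Lemma covered_or_charged_step (R : realType) (T : finType) (d : T -> T -> R)
    (pi : T -> seq T) (w : R) (st : state R T) :
  is_metric d -> separated d st ->
  covered d w st \/ charged d w st ->
  covered d w (dstep d pi st) \/ charged d w (dstep d pi st).
Proof.
move=> dm sep; have [dge0 d0 dC dtri] := dm.
have neqn i : (i <= nq st)%N -> (i == (nq st).+1) = false by lia.
have cov_step : covered d w st -> covered d w (dstep d pi st).
  move=> cov z; have [i [le_i lt_w le_d]] := cov z.
  by exists i; rewrite /= neqn // leqW.
case=> [cov|[near cnt]]; first by left; apply: cov_step.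
have [wide|narrow] := ltP w%:E (rad st (widest st)); last first.
  left; apply: cov_step => z.
  have dw : d z (ctr st (own st z)) <= w.
    rewrite -lee_fin; apply: le_trans (own_rad sep z) _.
    by apply: le_trans narrow; apply: widest_max; apply: (own_le sep).
  have [lt_w|le_w] := ltP w%:E (birth st (own st z)).
    exists (own st z); split=> //; first exact: (own_le sep).
    by have := dge0 z (ctr st (own st z)); lra.
  have [j [le_j lt_w dj]] := near _ (own_le sep z) le_w.
  exists j; split=> //.
  by have := dtri z (ctr st (own st z)) (ctr st j); lra.
right; have ble : (widest st <= nq st)%N by rewrite -ltnS.
have bw : (w%:E < birth st (widest st))%E.
  exact: lt_le_trans wide (rad_birth sep _).
split=> /= [i|].
  rewrite leq_eqVlt ltnS => /orP[/eqP ->|le_i].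
    rewrite eqxx lee_fin => vw; exists (widest st).
    by rewrite neqn // leqW //; split=> //; rewrite dC.
  rewrite neqn // => /(near _ le_i)[j [le_j lt_w dj]].
  by exists j; rewrite neqn // leqW.
(* Only the terms at the new index and at [widest] matter: an answer at most [w] adds one to both
   sums, a larger one changes neither. *)
rewrite big_ord_recr [X in (_ <= X)%N]big_ord_recr /= !eqxx /=.
under eq_bigr => i _ do rewrite neqn ?leq_ord //.
under [X in (_ <= X + _)%N]eq_bigr => i _ do rewrite neqn ?leq_ord //=.
rewrite [X in (_ <= X)%N](bigD1 (widest st)) //= in cnt.
rewrite [X in (_ <= X + _)%N](bigD1 (widest st)) //= eqxx bw /=.
rewrite [X in (_ <= _ + X + _)%N](eq_bigr (fun i : 'I_(nq st).+1 =>
  ((w%:E < birth st i) && (rad st i <= w%:E))%E : nat)); last first.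
  by move=> i; rewrite -val_eqE /= => /negbTE ->.
move: cnt; rewrite bw (leNgt (rad _ _)) wide /= !lee_fin lte_fin.
by move: (d _ _) => v; case: (ltP w v) => /=; lia.
Qed.

Lemma invariants_iter (R : realType) (T : finType) (d : T -> T -> R)
    (pi : T -> seq T) (x0 : T) (m : nat) :
  is_metric d -> consistent_profile d pi ->
  let st := iter m (dstep d pi) (start R x0) in
  separated d st /\ forall w, covered d w st \/ charged d w st.
Proof.
move=> dm cp; elim: m => [|m [sep cov]] /=; last first.
  split=> [|w]; first exact: separated_step.
  exact: covered_or_charged_step.
split=> [|w]; first exact: separated_start.
by right; split=> [i _ /=|/=]; rewrite ?big_ord1 /= ?leye_eq.
Qed.

(** * Size and cost of the output *)

Lemma card_top (R : realType) (I : finType) (f : I -> \bar R) (k : nat) :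
  (#|[set i | (#|[set j | (f i <= f j)%E]| <= k)%N]| <= k)%N.
Proof.
set A := [set i | _].
have [->|[i0 Ai0]] := set_0Vmem A; first by rewrite cards0.
(* All of [A] lies among the at most [k] indices counted for its least element. *)
case: (@Order.TotalTheory.arg_minP _ _ _ i0 (mem A) f Ai0) => i Ai min_i.
have le_k : (#|[set j | (f i <= f j)%E]| <= k)%N.
  by move: (Ai : i \in A); rewrite inE.
apply: leq_trans le_k; apply/subset_leq_card/subsetP => j Aj.
by rewrite inE min_i.
Qed.

Lemma card_output (R : realType) (T : finType) (k : nat) (st : state R T) :
  (#|output k st| <= k)%N.
Proof.
apply: leq_trans (leq_imset_card _ _) _.
by have := card_top (fun i : 'I_(nq st).+1 => birth st i) k; rewrite cardsE.
Qed.

Lemma pigeonhole_centers (R : realType) (T I : finType) (d : T -> T -> R)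
    (s : I -> T) (A : {set I}) (C : {set T}) (r : R) :
  is_metric d -> center_cost_le d C r -> (#|C| < #|A|)%N ->
  exists i j, [/\ i \in A, j \in A, i != j & d (s i) (s j) <= 2 * r].
Proof.
move=> [_ _ dC dtri] cost lt_CA.
pose c x := odflt x [pick c in C | d x c <= r].
have cP x : c x \in C /\ d x (c x) <= r.
  rewrite /c; case: pickP => [y /andP[]//|no].
  by have [y yC le_r] := cost x; have := no y; rewrite yC le_r.
have /dinjectivePn[i iA [j /andP[/= ji jA] eq_c]] : ~~ dinjectiveb (c \o s) A.
  apply/negP => /dinjectiveP /card_in_imset cardA.
  move: lt_CA; rewrite -cardA ltnNge => /negP; apply.
  by apply/subset_leq_card/subsetP => _ /imsetP[i _ ->]; case: (cP (s i)).
exists i, j; split=> //; first by rewrite eq_sym.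
have [_ di] := cP (s i); have [_ dj] := cP (s j).
have := dtri (s i) (c (s i)) (s j); rewrite /= in eq_c.
by rewrite {2}eq_c [d (c _) _]dC; lra.
Qed.

Lemma output_cost (R : realType) (T : finType) (d : T -> T -> R) (k : nat)
    (st : state R T) (C : {set T}) (r : R) :
  is_metric d -> nq st = (2 * k)%N -> separated d st ->
  (forall w, covered d w st \/ charged d w st) ->
  #|C| = k -> center_cost_le d C r -> center_cost_le d (output k st) (4 * r).
Proof.
move=> dm nqE sep cov cardC costC; have [dge0 d0 dC dtri] := dm.
pose f (i : 'I_(nq st).+1) := birth st i.
pose top i := [set j | (f i <= f j)%E].
have [imin big_min] : exists i, (k < #|top i|)%N.
  case: (Order.TotalTheory.arg_minP f (erefl : xpredT ord0)) => i _ min_i.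
  exists i; rewrite (_ : top i = setT) ?cardsT ?card_ord; first by lia.
  by apply/setP => j; rewrite !inE min_i.
(* [f istar] is the [(k+1)]-st largest birth. *)
have [istar big_star max_star] :=
  Order.TotalTheory.arg_maxP f (big_min : (fun i => k < #|top i|)%N imin).
have fge0 i : (0 <= f i)%E.
  exact: le_trans (rad_ge0 sep i) (rad_birth sep i).
(* Two of the more than [k] candidates in [top istar] share a center of [C]; separation bounds the
   smaller of their births by their distance. *)
have le_2r : (f istar <= (2 * r)%:E)%E.
  have [|i [j [it jt ij dij]]] :=
    pigeonhole_centers (fun i => ctr st (val i)) (A := top istar) dm costC.
    by rewrite cardC.
  wlog lt_ij : i j it jt ij dij / (i < j)%N.
    move=> wl; case: (ltngtP i j) => [|lt_ji|/val_inj eij]; first exact: wl.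
      by apply: (wl j i) => //; rewrite 1?eq_sym // dC.
    by rewrite eij eqxx in ij.
  move: it jt; rewrite !inE => it jt.
  have [|h|h] := ctr_sep sep (i := i) (j := j); first by rewrite lt_ij -ltnS /=.
    by apply: le_trans it (le_trans h _); rewrite lee_fin.
  by apply: le_trans jt (le_trans h _); rewrite lee_fin.
have [w fw] : exists w, f istar = w%:E.
  by case: (f istar) (fge0 istar) le_2r => [w| |] //; exists w.
rewrite fw lee_fin in le_2r.
have in_top i : (w%:E < f i)%E -> (#|top i| <= k)%N.
  by rewrite leqNgt => lt_w; apply/negP => /max_star; rewrite /= fw leNgt lt_w.
case: (cov w) => [covw|[_ cnt]].
  move=> z; have [i [le_i lt_w le_d]] := covw z.
  exists (ctr st i); last by lra.
  have lt_i : (i < (nq st).+1)%N by [].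
  apply/imsetP; exists (Ordinal lt_i) => //.
  by rewrite inE; apply: (in_top (Ordinal lt_i)).
(* In the charged case at most [k] candidates are born above [w] and no more than that at or below
   it, against a total of [2k+1]. *)
have le_k : (\sum_(i < (nq st).+1) (w%:E < birth st i)%E <= k)%N.
  rewrite -big_mkcond /= sum1_card; apply: leq_trans (card_top f k).
  by apply/subset_leq_card/subsetP => i /in_top; rewrite inE.
have : (\sum_(i < (nq st).+1)
    ((birth st i <= w%:E)%E + (w%:E < birth st i)%E) = (2 * k).+1)%N.
  rewrite -nqE -[RHS]card_ord -sum1_card; apply: eq_bigr => i _.
  by case: leP.
rewrite big_split /=.
have : (\sum_(i < (nq st).+1) ((w%:E < birth st i) && (rad st i <= w%:E))%E <=
  \sum_(i < (nq st).+1) (w%:E < birth st i)%E)%N.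
  by apply: leq_sum => i _; case: (w%:E < birth st i)%E => //=; apply: leq_b1.
move=> le_sum tot; exfalso; move: (leq_trans cnt le_sum) le_k tot.
by move: (bigop _ _ _) (bigop _ _ _) => a b; lia.
Qed.

Theorem mainTheorem3 (R : realType) (k : nat) (hk : (0 < k)%N) :
  exists A : forall n : nat, ('I_n -> seq 'I_n) -> qtree 'I_n R,
    forall (n : nat) (d : 'I_n -> 'I_n -> R) (pi : 'I_n -> seq 'I_n),
      is_metric d -> consistent_profile d pi ->
      let res := run d (A n pi) in
      [/\ (res.2 <= 2 * k)%N,
          (#|res.1| <= k)%N
        & forall (C' : {set 'I_n}) (r : R), #|C'| = k ->
            center_cost_le d C' r -> center_cost_le d res.1 (4 * r)].
Proof.
exists (fun n => if n is n'.+1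
  then fun pi => explore k pi (2 * k) (start R (ord0 : 'I_n'.+1))
  else fun=> QOut R set0).
case=> [|n] d pi dm cp res.
  (* With no points, the cost bound is vacuous. *)
  by split=> [||C' r _ _ []] //; rewrite /res /= cards0.
rewrite /res run_explore /=.
have [sep cov] := invariants_iter ord0 (2 * k) dm cp.
split=> [//||C' r]; first exact: card_output.
by apply: output_cost => //; rewrite nq_iter addn0.
Qed.
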